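(* Let $(\varepsilon_n)_{n\ge1}$ be a totally periodic sequence in $\{1,-1\}$ with minimal period $p$, let $(r_n)_{n\ge0}$ be the corresponding continued radical sequence, and let $r_\infty=\lim_{n\to\infty}r_n$. Let $u_n=2^n(r_\infty-r_n)$. Case I: If $\delta_p=1$, then $(u_n)$ has $p$ distinct limit points, which are $$2^j\left(\frac{2^p\sigma_p}{2^p-1}-\sigma_j\right)\frac{\pi}{2}\,\sin\left(\left(1-\frac{2^p\sigma_p}{2^p-1}\right)\frac{\pi}{4}\right),\qquad j=0,1,2,\dots,p-1.$$ Case II: If $\delta_p=-1$, then $(u_n)$ has $2p$ distinct limit points, which are $$2^j\left(\frac{2^p\sigma_p}{2^p+1}-\sigma_j\right)\frac{\pi}{2}\,\sin\left(\left(1-\frac{2^p\sigma_p}{2^p+1}\right)\frac{\pi}{4}\right),\qquad j=0,1,2,\dots,2p-1.$$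
   Context: For a sequence $(\varepsilon_n)_{n\ge1}$ in $\{1,-1\}$, the continued radical sequence is $r_0=\sqrt2$ and $r_n=\sqrt{2+\varepsilon_1\sqrt{2+\cdots+\varepsilon_n\sqrt{2}}}$ for $n\ge1$ (nonnegative square roots); it converges. The sequence $(\varepsilon_n)$ is totally periodic with period $p\in\mathbb{N}=\{1,2,\dots\}$ if $\varepsilon_{1+i+mp}=\varepsilon_{1+i}$ for all integers $m\ge0$ and all $i\in\{0,\dots,p-1\}$; the minimal period is the smallest such $p$. Notation: $\delta_0=0$, $\delta_i=\varepsilon_1\varepsilon_2\cdots\varepsilon_i$ for $i\ge1$, and $\sigma_j=\sum_{i=0}^{j}\frac{\delta_i}{2^i}$ for $j\ge0$. A limit point of a real sequence is the limit of some convergent subsequence. *)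

(* Defs.v *)
From mathcomp Require Import all_boot all_order all_algebra.
From mathcomp Require Import all_classical all_reals all_analysis.
Set Implicit Arguments.
Unset Strict Implicit.
Unset Printing Implicit Defensive.
Import Order.TTheory GRing.Theory Num.Theory.
Import numFieldNormedType.Exports.
Local Open Scope classical_set_scope.
Local Open Scope ring_scope.

(* Sign sequences are functions [eps : nat -> R] of which only the values at
   indices [n >= 1] matter; [eps 0] is never used. *)
Definition sign_seq (R : realType) (eps : nat -> R) : Prop :=
  forall n : nat, (1 <= n)%N -> eps n = 1 \/ eps n = -1.

(* [nested_radical eps k n] =
   sqrt(2 + eps_k sqrt(2 + ... + eps_(k+n-1) sqrt 2)), with [n] signs. *)
Fixpoint nested_radical (R : realType) (eps : nat -> R) (k n : nat) : R :=
  if n is n'.+1 then Num.sqrt (2 + eps k * nested_radical eps k.+1 n')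
  else Num.sqrt 2.

Definition continued_radical (R : realType) (eps : nat -> R) (n : nat) : R :=
  nested_radical eps 1 n.

Definition totally_periodic (R : realType) (eps : nat -> R) (p : nat) : Prop :=
  (1 <= p)%N /\
  forall m i : nat, (i < p)%N -> eps (1 + i + m * p)%N = eps (1 + i)%N.

Definition minimal_period (R : realType) (eps : nat -> R) (p : nat) : Prop :=
  totally_periodic eps p /\
  forall q : nat, totally_periodic eps q -> (p <= q)%N.

(* By convention [delta eps 0] is 0, not the empty product. *)
Definition delta (R : realType) (eps : nat -> R) (i : nat) : R :=
  if i == 0%N then 0 else \prod_(1 <= k < i.+1) eps k.

Definition sigma (R : realType) (eps : nat -> R) (j : nat) : R :=
  \sum_(0 <= i < j.+1) delta eps i / 2 ^+ i.

Definition subseq_limits (R : realType) (u : nat -> R) : set R :=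
  [set l | exists2 f : nat -> nat,
             {homo f : m n / (m < n)%N} & (fun n => u (f n)) @ \oo --> l].

(* Main.v *)
Require Import Defs.
From mathcomp Require Import all_boot all_order all_algebra.
From mathcomp Require Import all_classical all_reals all_analysis.
From mathcomp Require Import ring lra zify.
Set Implicit Arguments.
Unset Strict Implicit.
Unset Printing Implicit Defensive.
Import Order.TTheory GRing.Theory Num.Theory.
Import numFieldNormedType.Exports.
Local Open Scope classical_set_scope.
Local Open Scope card_scope.
Local Open Scope ring_scope.

(** Write [S] for the limit of [sigma eps n].  Everything rests on two facts.

    First, the substitution [x = 2 * sin phi] linearises the radicals: the
    half-angle formula turns [sqrt (2 + e * x)] into
    [2 * sin (pi / 4 + e * phi / 2)] for a sign [e] ([sqrt_half_angle]), so
    [r_n = 2 * sin (pi / 4 * (1 + sigma eps n))] ([continued_radical_sin]).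
    Differentiating the sine at the limit angle gives
    [u_n = t_n * (pi / 2) * sin ((1 - S) * (pi / 4)) + o(1)], where
    [t_n = 2 ^+ n * (S - sigma eps n)] is [scaled_tail eps S n]
    ([radical_asymptotics]).

    Second, [t_n] is the orbit of [S] under binary expansion with digits
    1 and -1: [t_(n+1) = 2 * t_n - delta_(n+1)].  If [eps] has period [p], then
    [delta_(n+p) = delta_p * delta_n], and the closed forms of [S] in the two
    cases are exactly the solutions of [t_p = delta_p * t_0]; hence
    [t_(n+p) = delta_p * t_n] and [t] has period [p] or [2 * p].  The limit
    points are therefore the values taken by the main term over one period
    ([subseq_limits_asymptotically_periodic]).

    These values are pairwise distinct.  A periodic orbit of this expanding
    recursion stays in [-1, 1], and in the open interval unless every sign is 1
    ([scaled_tail_lt1]); there the sign of [t_n] is the next digit, so equality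
    of [t_j] and [t_k] makes [k - j] a period of [eps]
    ([scaled_tail_eq_period]), against the minimality of [p].  In the
    exceptional case [p] is 1 and 0 is the only limit point. *)

(** * Continued radicals as sines *)

Lemma sqrt_half_angle (R : realType) (x : R) :
  - (pi / 2) <= x <= pi / 2 ->
  Num.sqrt (2 + 2 * sin x) = 2 * sin (pi / 4 + x / 2).
Proof.
move=> /andP[xge xle]; set y := pi / 4 + x / 2.
have pi0 := @pi_gt0 R.
have sinx : sin x = - cos (y *+ 2).
  have -> : y *+ 2 = x + pi / 2 by rewrite /y; field.
  by rewrite cosDpihalf opprK.
have -> : 2 + 2 * sin x = (2 * sin y) ^+ 2.
  by rewrite sinx cos_mulr2n cos2sin2; ring.
rewrite sqrtr_sqr ger0_norm// mulr_ge0// sin_ge0_pi//.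
by rewrite /y; apply/andP; split; lra.
Qed.

(** The analogue of [sigma] for a radical that starts at the sign of index [k];
    the shift of [k] is what makes the recursion on nested radicals close. *)
Definition radical_angle (R : realType) (eps : nat -> R) (k n : nat) : R :=
  \sum_(1 <= i < n.+1) (\prod_(k <= j < k + i) eps j) / 2 ^+ i.

Lemma radical_angleS (R : realType) (eps : nat -> R) (k n : nat) :
  radical_angle eps k n.+1 = eps k / 2 * (1 + radical_angle eps k.+1 n).
Proof.
rewrite /radical_angle big_ltn// addn1 big_nat1 expr1 mulrDr mulr1.
congr (_ + _).
rewrite big_add1/= big_distrr/=; apply: eq_big_nat => i /andP[i1 _].
rewrite addnS big_ltn; last by lia.
by rewrite addSn exprS; field.
Qed.

(** This keeps the angle [pi / 4 * (1 + radical_angle eps k n)] in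
    [0, pi / 2], the range where the half-angle formula has the right sign. *)
Lemma radical_angle_bound (R : realType) (eps : nat -> R) (k n : nat) :
  sign_seq eps -> (1 <= k)%N -> `|radical_angle eps k n| <= 1.
Proof.
move=> es; elim: n k => [|n IH] k k1.
  by rewrite /radical_angle big_geq// normr0.
rewrite radical_angleS; have := IH k.+1 isT.
rewrite !ler_norml => /andP[? ?].
by case: (es k k1) => ->; apply/andP; split; lra.
Qed.

Lemma nested_radical_sin (R : realType) (eps : nat -> R) (k n : nat) :
  sign_seq eps -> (1 <= k)%N ->
  nested_radical eps k n = 2 * sin (pi / 4 * (1 + radical_angle eps k n)).
Proof.
move=> es; elim: n k => [|n IH] k k1 /=.
  rewrite /radical_angle big_geq// addr0 mulr1.
  have := @sqrt_half_angle R 0; rewrite sin0 mulr0 mul0r !addr0; apply.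
  by have := @pi_gt0 R => ?; apply/andP; split; lra.
rewrite IH// radical_angleS.
have := radical_angle_bound n es (ltn0Sn k); rewrite ler_norml => /andP[t1 t2].
set t := radical_angle _ _ _ in t1 t2 *.
have pi0 := @pi_gt0 R.
have phi1 : 0 <= pi / 4 * (1 + t) by apply: mulr_ge0; lra.
have phi2 : pi / 4 * (1 + t) <= pi / 2.
  have -> : pi / 2 = pi / 4 * 2 :> R by field.
  by rewrite ler_pM2l; lra.
set phi := pi / 4 * (1 + t) in phi1 phi2 *.
have -> : eps k * (2 * sin phi) = 2 * sin (eps k * phi).
  by case: (es k k1) => ->; rewrite ?mul1r ?mulN1r ?sinN ?mulrN.
rewrite sqrt_half_angle; last by case: (es k k1) => ->; apply/andP; split; lra.
by congr (2 * sin _); rewrite /phi; field.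
Qed.

Lemma sigma_radical_angle (R : realType) (eps : nat -> R) (n : nat) :
  sigma eps n = radical_angle eps 1 n.
Proof.
rewrite /sigma /radical_angle big_ltn// {1}/delta eqxx mul0r add0r.
apply: eq_big_nat => i /andP[i1 _].
by rewrite /delta -[i in if i == _ then _ else _]prednK.
Qed.

Lemma continued_radical_sin (R : realType) (eps : nat -> R) (n : nat) :
  sign_seq eps ->
  continued_radical eps n = 2 * sin (pi / 4 * (1 + sigma eps n)).
Proof.
by move=> es; rewrite sigma_radical_angle; exact: nested_radical_sin.
Qed.

(** * Recurrences and periodicity of the signs *)

Lemma deltaS (R : realType) (eps : nat -> R) (n : nat) :
  (1 <= n)%N -> delta eps n.+1 = delta eps n * eps n.+1.
Proof.
by move=> n1; rewrite /delta [n == 0%N]gtn_eqF//= big_nat_recr.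
Qed.

Lemma delta_sign (R : realType) (eps : nat -> R) (n : nat) :
  sign_seq eps -> (1 <= n)%N -> delta eps n = 1 \/ delta eps n = -1.
Proof.
move=> es; elim: n => // -[_ _|n IH _].
  by rewrite /delta/= big_nat1; exact: es.
rewrite deltaS//; case: (IH isT) => ->; case: (es n.+2 isT) => ->;
  rewrite ?mulN1r ?mul1r ?opprK; by [left|right].
Qed.

Lemma sigmaS (R : realType) (eps : nat -> R) (n : nat) :
  sigma eps n.+1 = sigma eps n + delta eps n.+1 / 2 ^+ n.+1.
Proof. by rewrite /sigma big_nat_recr. Qed.

Lemma sigma0 (R : realType) (eps : nat -> R) : sigma eps 0 = 0.
Proof. by rewrite /sigma big_nat1 /delta eqxx mul0r. Qed.

(** The division with remainder in the definition is traded for the usual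
    invariance under translation by [p]. *)
Lemma totally_periodicP (R : realType) (eps : nat -> R) (p : nat) :
  totally_periodic eps p <->
  (1 <= p)%N /\ forall n, (1 <= n)%N -> eps (n + p)%N = eps n.
Proof.
split=> -[p1 per]; split=> //.
  move=> n n1.
  have lt_np : (n.-1 %% p < p)%N by rewrite ltn_mod.
  have nE : (n = 1 + n.-1 %% p + n.-1 %/ p * p)%N.
    by have := divn_eq n.-1 p; lia.
  have npE : (n + p = 1 + n.-1 %% p + (n.-1 %/ p).+1 * p)%N.
    by rewrite mulSn; lia.
  by rewrite npE [in RHS]nE !per.
elim=> [|m IH] i ip; first by rewrite mul0n addn0.
by rewrite mulSn (addnC p) addnA per ?IH// add1n.
Qed.

Lemma totally_periodic_mul (R : realType) (eps : nat -> R) (p m n : nat) :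
  totally_periodic eps p -> (1 <= n)%N -> eps (n + m * p)%N = eps n.
Proof.
move=> /totally_periodicP[p1 per] n1; elim: m => [|m IH].
  by rewrite mul0n addn0.
by rewrite mulSn (addnC p) addnA per ?IH// addn_gt0 n1.
Qed.

(** For a purely periodic sequence an eventual period is a period, since any
    index can be moved beyond [N] by a multiple of [p]. *)
Lemma totally_periodic_eventually (R : realType) (eps : nat -> R)
    (p d N : nat) :
  totally_periodic eps p -> (1 <= d)%N ->
  (forall n, (N <= n)%N -> eps (n + d)%N = eps n) -> totally_periodic eps d.
Proof.
move=> per d1 evd; apply/totally_periodicP; split=> // n n1.
rewrite -(totally_periodic_mul N per n1).
have nd1 : (1 <= n + d)%N by lia.
rewrite -(totally_periodic_mul N per nd1).
rewrite addnAC evd// (leq_trans _ (leq_addl _ _))//.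
by rewrite leq_pmulr//; case: per.
Qed.

Lemma deltaD (R : realType) (eps : nat -> R) (p n : nat) :
  totally_periodic eps p -> (1 <= n)%N ->
  delta eps (n + p) = delta eps p * delta eps n.
Proof.
move=> /totally_periodicP[p1 per]; elim: n => // -[_ _|n IH _].
  by rewrite add1n deltaS// -add1n per// {3}/delta/= big_nat1.
by rewrite addSn deltaS// IH// -addSn per// [in RHS]deltaS// mulrA.
Qed.

(** * Scaled tails of the sign series *)

(** The number [S] is a parameter rather than a limit: the two closed forms
    that are substituted for it are shown to be the limit of [sigma] only
    afterwards ([cvg_sigma]). *)
Definition scaled_tail (R : realType) (eps : nat -> R) (S : R) (n : nat) : R :=
  2 ^+ n * (S - sigma eps n).

Lemma scaled_tailS (R : realType) (eps : nat -> R) (S : R) (n : nat) :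
  scaled_tail eps S n.+1 = 2 * scaled_tail eps S n - delta eps n.+1.
Proof.
rewrite /scaled_tail sigmaS exprS.
have : 2 ^+ n != 0 :> R by rewrite expf_neq0.
by move=> ?; field.
Qed.

Lemma scaled_tail0 (R : realType) (eps : nat -> R) (S : R) :
  scaled_tail eps S 0 = S.
Proof. by rewrite /scaled_tail sigma0 mul1r subr0. Qed.

Lemma scaled_tailD (R : realType) (eps : nat -> R) (S : R) (p n : nat) :
  totally_periodic eps p -> scaled_tail eps S p = delta eps p * S ->
  scaled_tail eps S (n + p) = delta eps p * scaled_tail eps S n.
Proof.
move=> per tp; elim: n => [|n IH]; first by rewrite add0n tp scaled_tail0.
by rewrite addSn !scaled_tailS IH -addSn deltaD//; ring.
Qed.

(** Outside of [-1, 1] the recursion of the scaled tails is expanding. *)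
Lemma scaled_tail_growth (R : realType) (eps : nat -> R) (S : R) (n m : nat) :
  sign_seq eps ->
  2 ^+ m * (`|scaled_tail eps S n| - 1) <= `|scaled_tail eps S (n + m)| - 1.
Proof.
move=> es; elim: m => [|m IH]; first by rewrite mul1r addn0.
rewrite exprS -mulrA.
apply: (@le_trans _ _ (2 * (`|scaled_tail eps S (n + m)| - 1))).
  by rewrite ler_pM2l.
rewrite addnS scaled_tailS.
have d1 : `|delta eps (n + m).+1| = 1.
  by case: (delta_sign es (ltn0Sn (n + m))) => ->; rewrite ?normrN normr1.
have := lerB_dist (2 * scaled_tail eps S (n + m)) (delta eps (n + m).+1).
by rewrite d1 normrM ger0_norm//; lra.
Qed.

(** By expansion, a tail of absolute value above 1 could never recur. *)
Lemma scaled_tail_le1 (R : realType) (eps : nat -> R) (S : R) (q n : nat) :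
  sign_seq eps -> (0 < q)%N ->
  (forall n, scaled_tail eps S (n + q) = scaled_tail eps S n) ->
  `|scaled_tail eps S n| <= 1.
Proof.
move=> es q0 per; rewrite leNgt; apply/negP => t1.
have := scaled_tail_growth S n q es; rewrite per leNgt => /negP; apply.
by rewrite ltr_pMl ?subr_gt0// exprn_egt1 ?ltr1n// -lt0n.
Qed.

(** A tail equal to 1 or -1 must be followed by digits all equal to it, since
    any other digit would lead out of [-1, 1]; constant digits mean that the
    signs are eventually 1, and by periodicity they are all 1. *)
Lemma scaled_tail_lt1 (R : realType) (eps : nat -> R) (S : R) (p n : nat) :
  sign_seq eps -> totally_periodic eps p ->
  (forall n, `|scaled_tail eps S n| <= 1) ->
  ~ (forall k, (1 <= k)%N -> eps k = 1) -> `|scaled_tail eps S n| < 1.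
Proof.
move=> es per t1 neps; rewrite lt_neqAle t1 andbT; apply/eqP => tn1.
have eqt i : delta eps (n + i).+1 = scaled_tail eps S n /\
             scaled_tail eps S (n + i).+1 = scaled_tail eps S n.
  have step m : `|scaled_tail eps S m| = 1 ->
      delta eps m.+1 = scaled_tail eps S m /\
      scaled_tail eps S m.+1 = scaled_tail eps S m.
    have := t1 m.+1; rewrite scaled_tailS ler_norml => /andP[].
    by have [->|->] := delta_sign es (ltn0Sn m);
      case: (ger0P (scaled_tail eps S m)); lra.
  elim: i => [|i [IH1 IH2]]; first by rewrite addn0; exact: step.
  by rewrite addnS; have := step (n + i).+1; rewrite IH2; apply.
apply: neps => m m1; have [p1 _] := per.
have eps1 k : (n.+2 <= k)%N -> eps k = 1.
  move=> nk; have kE : k = (n + (k - n.+2).+1).+1 by lia.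
  have [d1 _] := eqt (k - n.+2)%N; have [d2 _] := eqt (k - n.+2).+1.
  move: d2; rewrite deltaS; last by lia.
  rewrite -kE addnS d1 => /(congr1 ( *%R (scaled_tail eps S n))).
  have : scaled_tail eps S n * scaled_tail eps S n = 1.
    by rewrite -expr2 -[LHS]ger0_norm ?sqr_ge0// normrX tn1 expr1n.
  by move=> tt; rewrite mulrA tt mul1r.
rewrite -(totally_periodic_mul n.+2 per m1); apply: eps1.
by rewrite (leq_trans _ (leq_addl _ _))// leq_pmulr.
Qed.

(** For values in the open interval the next digit is the sign of the current
    tail, so equal tails generate equal digits. *)
Lemma scaled_tail_digits (R : realType) (eps : nat -> R) (S : R) (j k i : nat) :
  sign_seq eps -> (forall n, `|scaled_tail eps S n| < 1) ->
  scaled_tail eps S j = scaled_tail eps S k ->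
  delta eps (j + i).+1 = delta eps (k + i).+1.
Proof.
move=> es t1 tjk.
have step m n : scaled_tail eps S m = scaled_tail eps S n ->
    delta eps m.+1 = delta eps n.+1.
  move=> tmn; have := t1 m.+1; have := t1 n.+1.
  rewrite !scaled_tailS tmn !ltr_norml.
  move=> /andP[+ +] /andP[].
  by have [->|->] := delta_sign es (ltn0Sn m);
    have [->|->] := delta_sign es (ltn0Sn n); lra.
suff : scaled_tail eps S (j + i) = scaled_tail eps S (k + i) by exact: step.
elim: i => [|i IH]; first by rewrite !addn0.
by rewrite !addnS !scaled_tailS IH (step _ _ IH).
Qed.

(** A sign is the product of two consecutive digits, hence the coincidence of
    the digits from [j] and from [k] on passes to the signs. *)
Lemma scaled_tail_eq_period (R : realType) (eps : nat -> R) (S : R)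
    (p j k : nat) :
  sign_seq eps -> totally_periodic eps p ->
  (forall n, `|scaled_tail eps S n| < 1) -> (j < k)%N ->
  scaled_tail eps S j = scaled_tail eps S k -> totally_periodic eps (k - j).
Proof.
move=> es per t1 jk tjk.
apply: (@totally_periodic_eventually _ _ p _ j.+2 per).
  by rewrite subn_gt0.
move=> n jn.
have epsE m : (1 <= m)%N -> eps m.+1 = delta eps m * delta eps m.+1.
  move=> m1; rewrite deltaS// mulrA.
  by case: (delta_sign es m1) => ->;
    rewrite ?mulrN1 ?mulN1r ?opprK ?mulr1 mul1r.
have -> : n = (j + (n - j.+2).+1).+1 by lia.
rewrite (_ : (_ + (k - j) = (k + (n - j.+2).+1).+1)%N); last by lia.
rewrite !epsE; [|lia|lia].
rewrite !(scaled_tail_digits _ es t1 tjk) !addnS.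
by rewrite (scaled_tail_digits _ es t1 tjk).
Qed.

(** Equal tails at [j < k] make [k - j] a period.  This is below the minimal
    period if [q = p].  If [q = 2 * p], only [k - j = p] survives, and then the
    digits at [j] and [k] are opposite because [delta eps p = -1]. *)
Lemma scaled_tail_distinct (R : realType) (eps : nat -> R) (S : R)
    (p q j k : nat) :
  sign_seq eps -> minimal_period eps p ->
  scaled_tail eps S p = delta eps p * S ->
  delta eps p = 1 /\ q = p \/ delta eps p = -1 /\ q = (2 * p)%N ->
  (forall n, `|scaled_tail eps S n| < 1) ->
  (j < k < q)%N -> scaled_tail eps S j <> scaled_tail eps S k.
Proof.
move=> es [per pmin] tp dq t1 /andP[jk kq] tjk.
have perd := scaled_tail_eq_period es per t1 jk tjk.
have pd := pmin _ perd.
case: dq => -[dp qE]; first by move: kq; rewrite qE; lia.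
have [dp_eq|dp_neq] := eqVneq (k - j)%N p.
  have kE : k = (j + p)%N by lia.
  have := scaled_tail_digits 0 es t1 tjk.
  rewrite !addn0 kE -addSn deltaD// dp.
  by case: (delta_sign es (ltn0Sn j)) => ->; lra.
have : totally_periodic eps (k - j - p).
  apply: (@totally_periodic_eventually _ _ p _ 1 per); first by lia.
  move=> n n1; have [_ perp] := (totally_periodicP eps p).1 per.
  have [_ perk] := (totally_periodicP eps _).1 perd.
  rewrite -perp; last by lia.
  by rewrite (_ : n + _ + p = n + (k - j))%N ?perk//; lia.
by move/pmin; move: kq; rewrite qE; lia.
Qed.

(** * Limit points of asymptotically periodic sequences *)

(** Along a subsequence the periodic part takes values in a finite, hence
    closed, set, which catches the limit; each value is reached along its own
    residue class. *)
Lemma subseq_limits_asymptotically_periodic (R : realType) (u v : nat -> R)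
    (q : nat) :
  (0 < q)%N -> (forall n, v (n + q)%N = v n) ->
  (fun n => u n - v n) @ \oo --> 0 ->
  subseq_limits u = [set v j | j in `I_q].
Proof.
move=> q0 per uv.
have vmod n : v n = v (n %% q)%N.
  rewrite [in LHS](divn_eq n q) addnC; elim: (n %/ q)%N => [|m IH].
    by rewrite mul0n addn0.
  by rewrite mulSn (addnC q) addnA per.
have geid (f : nat -> nat) :
    {homo f : m n / (m < n)%N} -> forall n, (n <= f n)%N.
  by move=> fh; elim=> // n IH; apply: leq_ltn_trans IH (fh _ _ _).
have fcvg (f : nat -> nat) : {homo f : m n / (m < n)%N} -> f @ \oo --> \oo.
  move=> fh; apply/cvgnyPge => A; near=> n.
  by apply: leq_trans (geid _ fh n); near: n; exact: nbhs_infty_ge.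
have uvf (f : nat -> nat) : {homo f : m n / (m < n)%N} ->
    (fun n => u (f n) - v (f n)) @ \oo --> 0.
  by move=> fh; apply: cvg_comp (fcvg f fh) uv.
apply/seteqP; split=> [l [f fh fl]|l [j jq <-]].
  have vl : (fun n => v (f n)) @ \oo --> l.
    rewrite -[l]subr0 (_ : (fun n => _) =
        (fun n => u (f n) - (u (f n) - v (f n)))).
      by apply: cvgB => //; exact: uvf.
    by apply/funext => n; rewrite opprB addrC subrK.
  apply: (@closed_cvg _ _ \oo _ (fun n => v (f n)) [set v j | j in `I_q]) vl.
    have := (@accessible_finite_set_closed R).1
      (hausdorff_accessible (@Rhausdorff R)).
    by apply; exact/finite_image/finite_II.
  apply: nearW => n; exists (f n %% q)%N; last by rewrite -vmod.
  by rewrite /= ltn_mod.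
exists (fun n => j + n * q)%N.
  by move=> m n mn; rewrite ltn_add2l ltn_pmul2r.
have fh : {homo (fun n => j + n * q)%N : m n / (m < n)%N}.
  by move=> m n mn; rewrite ltn_add2l ltn_pmul2r.
rewrite -[v j]add0r (_ : (fun n => _) =
    (fun n => (u (j + n * q)%N - v (j + n * q)%N) + v j)).
  by apply: cvgD; [exact: uvf fh|exact: cvg_cst].
apply/funext => n; rewrite [v (j + _)%N]vmod -[(j + n * q)%N]addnC modnMDl.
by rewrite -vmod subrK.
Unshelve. all: by end_near. Qed.

(** * Asymptotics of the continued radical *)

Lemma cvg_sigma (R : realType) (eps : nat -> R) (S : R) :
  (forall n, `|scaled_tail eps S n| <= 1) -> sigma eps n @[n --> \oo] --> S.
Proof.
move=> t1; apply/cvgrPdist_le => e e0.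
have h1 : `|2^-1 : R| < 1 by rewrite ger0_norm; lra.
have := cvg_expr h1 => /cvgr0_norm_le /(_ e e0) [N _ HN].
exists N => // n Nn /=.
apply: le_trans (HN n Nn); rewrite normrX ger0_norm ?invr_ge0//.
rewrite exprVn -[leRHS]mul1r ler_pdivlMr ?exprn_gt0// mulrC.
by have := t1 n; rewrite /scaled_tail normrM ger0_norm.
Qed.

(** The slope function [g] of the sine at the limit angle, continuous there,
    gives the exact formula [u_n = t_n * (pi / 2) * g y_n], including for
    [t_n = 0]; the boundedness of [t_n] then leaves only [g y_n --> g x]. *)
Lemma radical_asymptotics (R : realType) (eps : nat -> R) (S : R) :
  sign_seq eps -> (forall n, `|scaled_tail eps S n| <= 1) ->
  let r := continued_radical eps in
  (fun n => 2 ^+ n * (limn r - r n) -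
     scaled_tail eps S n * (pi / 2) * sin ((1 - S) * (pi / 4))) @ \oo --> 0.
Proof.
move=> es t1 r; set x : R := pi / 4 * (1 + S).
pose y n := pi / 4 * (1 + sigma eps n).
have yx : y @ \oo --> x.
  apply: cvgM; first exact: cvg_cst.
  by apply: cvgD; [exact: cvg_cst|exact: cvg_sigma].
have rE n : r n = 2 * sin (y n) by exact: continued_radical_sin.
have rlim : limn r = 2 * sin x.
  apply/cvg_lim => //.
  rewrite (_ : r = fun n => 2 * sin (y n)); last exact/funext.
  apply: cvgM; first exact: cvg_cst.
  by apply: continuous_cvg yx; exact: continuous_sin.
have [g [gE gx gcos]] := (is_derive1_caratheodory _ _ _).1 (is_derive_sin x).
have sinE : sin ((1 - S) * (pi / 4)) = g x.
  by rewrite gcos -cosBpihalf -cosN; congr cos; rewrite /x; field.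
have gy : (fun n => (pi / 2) * `|g (y n) - g x|) @ \oo --> 0.
  rewrite -[0](mulr0 (pi / 2)); apply: cvgM; first exact: cvg_cst.
  apply/norm_cvg0P; apply/subr_cvg0; exact: cvg_comp yx gx.
apply/norm_cvg0P; apply: (squeeze_cvgr _ (cvg_cst 0) gy); apply: nearW => n.
rewrite normr_ge0/= rlim rE sinE.
have -> : 2 ^+ n * (2 * sin x - 2 * sin (y n)) =
          scaled_tail eps S n * (pi / 2) * g (y n).
  have -> : 2 * sin x - 2 * sin (y n) = - 2 * (sin (y n) - sin x) by ring.
  by rewrite gE /x /y /scaled_tail; field.
have -> : scaled_tail eps S n * (pi / 2) * g (y n) -
          scaled_tail eps S n * (pi / 2) * g x =
          scaled_tail eps S n * ((pi / 2) * (g (y n) - g x)) by ring.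
have pi2 : 0 <= pi / 2 :> R by rewrite divr_ge0// pi_ge0.
by rewrite [leLHS]normrM (normrM (pi / 2)) (ger0_norm pi2) ler_piMl// mulr_ge0.
Qed.

(** * Limit points over a minimal period *)

(** The angle lies strictly between 0 and [pi / 2]; at [S = 1], where all signs
    are 1, the factor would vanish. *)
Lemma limit_factor_neq0 (R : realType) (S : R) :
  `|S| < 1 -> (pi / 2) * sin ((1 - S) * (pi / 4)) != 0.
Proof.
rewrite ltr_norml => /andP[S1 S2]; have pi0 := @pi_gt0 R.
apply: lt0r_neq0; apply: mulr_gt0; first by rewrite divr_gt0.
apply: sin_gt0_pi; apply/andP; split.
  by rewrite mulr_gt0 ?divr_gt0// subr_gt0.
have : 0 < (3 + S) * (pi / 4) by rewrite mulr_gt0 ?divr_gt0//; lra.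
by lra.
Qed.

Lemma radical_limit_points (R : realType) (eps : nat -> R) (S : R) (q : nat) :
  sign_seq eps -> (0 < q)%N ->
  (forall n, scaled_tail eps S (n + q) = scaled_tail eps S n) ->
  let r := continued_radical eps in
  subseq_limits (fun n => 2 ^+ n * (limn r - r n)) =
  [set scaled_tail eps S j * (pi / 2) * sin ((1 - S) * (pi / 4)) | j in `I_q].
Proof.
move=> es q0 per r; apply: subseq_limits_asymptotically_periodic => //.
  by move=> n; rewrite per.
by apply: radical_asymptotics => // n; exact: scaled_tail_le1 per.
Qed.

(** The two cases of the theorem differ only in the equation that [S] solves and
    in the period [q] of the scaled tails, so they share one argument. *)
Lemma radical_limit_points_minimal_period (R : realType) (eps : nat -> R)
    (S : R) (p q : nat) :
  sign_seq eps -> minimal_period eps p ->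
  scaled_tail eps S p = delta eps p * S ->
  delta eps p = 1 /\ q = p \/ delta eps p = -1 /\ q = (2 * p)%N ->
  let r := continued_radical eps in
  let L := [set scaled_tail eps S j * (pi / 2) * sin ((1 - S) * (pi / 4))
           | j in `I_q] in
  subseq_limits (fun n => 2 ^+ n * (limn r - r n)) #= `I_q /\
  subseq_limits (fun n => 2 ^+ n * (limn r - r n)) = L.
Proof.
move=> es pmin tp dq r L; have [per leper] := pmin; have [p1 _] := per.
have q0 : (0 < q)%N by case: dq => -[_ ->]; lia.
have tper n : scaled_tail eps S (n + q) = scaled_tail eps S n.
  case: dq => -[dp ->]; first by rewrite (scaled_tailD _ per tp) dp mul1r.
  by rewrite mul2n -addnn addnA !(scaled_tailD _ per tp) dp !mulN1r opprK.
have limE : subseq_limits (fun n => 2 ^+ n * (limn r - r n)) = L.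
  exact: radical_limit_points tper.
rewrite limE; split=> //; apply: inj_card_eq => j k; rewrite !inE/= => jq kq.
(* If all signs are 1 the common factor vanishes, but then the index set is a
   singleton; otherwise the factor is nonzero and the tails are distinct. *)
have [eps1|neps1] := pselect (forall k, (1 <= k)%N -> eps k = 1).
  have p_1 : p = 1%N.
    apply/eqP; rewrite eqn_leq p1 andbT leper//.
    by apply/totally_periodicP; split=> // n n1; rewrite !eps1// addn1.
  have q1 : q = 1%N.
    case: dq => -[]; first by move=> _ ->.
    by rewrite p_1 /delta/= big_nat1 eps1// => d1; exfalso; lra.
  by move: jq kq; rewrite q1 !ltnS !leqn0 => /eqP-> /eqP->.
have t1 n : `|scaled_tail eps S n| < 1.
  by apply: (scaled_tail_lt1 _ es per) => // m; exact: scaled_tail_le1 tper.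
have S1 : `|S| < 1 by rewrite -(scaled_tail0 eps S).
rewrite -!(mulrA _ (pi / 2)) => /(mulIf (limit_factor_neq0 S1)) tjk.
have dist := scaled_tail_distinct es pmin tp dq t1.
case: (ltngtP j k) => // jk.
  by case: (dist j k); rewrite ?jk.
by case: (dist k j); rewrite ?jk.
Qed.

Theorem theorem6 (R : realType) (eps : nat -> R) (p : nat)
    (eps_sign : sign_seq eps) (eps_period : minimal_period eps p) :
  let r := continued_radical eps in
  let r_oo := limn r in
  let u := fun n : nat => 2 ^+ n * (r_oo - r n) in
  (delta eps p = 1 ->
     subseq_limits u #= `I_p /\
     subseq_limits u =
       [set 2 ^+ j * (2 ^+ p * sigma eps p / (2 ^+ p - 1) - sigma eps j)
            * (pi / 2)
            * sin ((1 - 2 ^+ p * sigma eps p / (2 ^+ p - 1)) * (pi / 4))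
       | j in `I_p]) /\
  (delta eps p = -1 ->
     subseq_limits u #= `I_(2 * p) /\
     subseq_limits u =
       [set 2 ^+ j * (2 ^+ p * sigma eps p / (2 ^+ p + 1) - sigma eps j)
            * (pi / 2)
            * sin ((1 - 2 ^+ p * sigma eps p / (2 ^+ p + 1)) * (pi / 4))
       | j in `I_(2 * p)]).
Proof.
move=> r r_oo u.
have [[p1 _] _] := eps_period.
have two_p : 2 <= 2 ^+ p :> R by rewrite -[leLHS]expr1 ler_eXn2l ?ltr1n.
(* The closed form of [S] solves
   [2 ^+ p * (S - sigma eps p) = delta eps p * S]. *)
split=> dp.
  apply: (radical_limit_points_minimal_period eps_sign eps_period);
    last by left; split.
  by rewrite /scaled_tail dp mul1r; field; rewrite gt_eqF//; lra.
apply: (radical_limit_points_minimal_period eps_sign eps_period);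
  last by right; split.
by rewrite /scaled_tail dp mulN1r; field; rewrite gt_eqF//; lra.
Qed.
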